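(* Let $G$ be a group. (1) Each irreducible Levi monoid with group of units $G$ can be constructed from an isomorphism between two divisors of $G$: if $S$ is an irreducible Levi monoid with group of units $G$, then there are subgroups $H,K\le G$, normal subgroups $N_H\trianglelefteq H$ and $N_K\trianglelefteq K$, and an isomorphism $\theta\colon H/N_H\rightarrow K/N_K$ such that $S$ is isomorphic to $\mathsf{T}(\overline{X}(H,\gamma,K))$, where $\gamma=\{(h,k)\in H\times K\colon \theta(hN_H)=kN_K\}$. (2) Each irreducible left Rees monoid with group of units $G$ can be constructed from a partial endomorphism of $G$: if $S$ is an irreducible left Rees monoid with group of units $G$, then there are subgroups $H,K\le G$ and a surjective homomorphism $\phi\colon H\rightarrow K$ such that $S$ is isomorphic to $\mathsf{T}(\overline{X}(H,\gamma,K))$, where $\gamma=\{(h,\phi(h))\colon h\in H\}$. (3) Each irreducible Rees monoid with group of units $G$ can be constructed from a partial automorphism of $G$: if $S$ is an irreducible Rees monoid with group of units $G$, then there are subgroups $H,K\le G$ and an isomorphism $\phi\colon H\rightarrow K$ such that $S$ is isomorphic to $\mathsf{T}(\overline{X}(H,\gamma,K))$, where $\gamma=\{(h,\phi(h))\colon h\in H\}$.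
   Context: A length function on a monoid $S$ is a monoid homomorphism $\lambda \colon S \rightarrow \mathbb{N}$ to the additive monoid of natural numbers (including $0$) such that $\lambda^{-1}(0)$ is the group of units of $S$. A monoid $S$ is equidivisible if for all $a,b,c,d\in S$, $ab=cd$ implies that either $a=cu$ and $d=ub$ for some $u\in S$, or $c=av$ and $b=vd$ for some $v\in S$. A Levi monoid is an equidivisible monoid equipped with a length function which contains at least one noninvertible element. A left Rees monoid is a left cancellative Levi monoid; a Rees monoid is a cancellative Levi monoid. An atom is a noninvertible element $a$ such that $a=bc$ implies that $b$ or $c$ is invertible. A Levi monoid with group of units $G$ is irreducible if for all atoms $x,y$ there are $g,h\in G$ with $y=gxh$. A divisor of a group $G$ is a homomorphic image of a subgroup of $G$, i.e. (up to isomorphism) a group $H/N$ with $N\trianglelefteq H\le G$. A partial endomorphism of $G$ is a surjective homomorphism $\phi\colon H\rightarrow K$ between subgroups $H,K\le G$; if it is an isomorphism it is called a partial automorphism. A $G$-bimodule is a non-empty set with commuting left and right $G$-actions, $(gx)h=g(xh)$. Given subgroups $H,K\le G$ and a subgroup $\gamma\le H\times K$ projecting onto both components, define an equivalence relation on $G\times G$ by $(g_1,h_1)\equiv(g_2,h_2)$ iff $g_2^{-1}g_1\in H$, $h_2h_1^{-1}\in K$ and $(g_2^{-1}g_1,h_2h_1^{-1})\in\gamma$. Let $[g,h]$ be the class of $(g,h)$ and $\overline{X}(H,\gamma,K)$ the set of classes, which is a $G$-bimodule under $g[g_1,h_1]=[gg_1,h_1]$ and $[g_1,h_1]g=[g_1,h_1g]$.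 For a $G$-bimodule $X$, put $X^{\otimes 0}=G$, $X^{\otimes 1}=X$, and for $n\ge 2$ let $X^{\otimes n}$ be the $n$-fold tensor product over $G$: the set of symbols $x_1\otimes\cdots\otimes x_n$ ($x_i\in X$), where $x_1\otimes\cdots\otimes x_n=y_1\otimes\cdots\otimes y_n$ iff there are $g_1,\dots,g_{n-1}\in G$ with $y_1=x_1g_1$, $y_i=g_{i-1}^{-1}x_ig_i$ for $1<i<n$, and $y_n=g_{n-1}^{-1}x_n$. The tensor monoid is $\mathsf{T}(X)=\bigcup_{n\ge 0}X^{\otimes n}$ (disjoint union), with multiplication given by tensoring (concatenating) sequences, by the left and right actions of $G$ when one factor lies in $G$ (on the first, respectively last, entry), and by the multiplication of $G$ when both do. *)

(* Defs.v *)
From HB Require Import structures.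
From mathcomp Require Import all_boot.
From mathcomp Require Import boolp.

Set Implicit Arguments.
Unset Strict Implicit.
Unset Printing Implicit Defensive.

Local Open Scope group_scope.
Local Open Scope quotient_scope.

(* Groups and monoids are the groupType and monoidType of MathComp, whose
   carriers may be infinite.  These carriers are choiceTypes; classically every
   type is one (boolp.gen_choiceMixin). *)

Definition invertible (S : monoidType) (a : S) : Prop :=
  exists b : S, a * b = 1 /\ b * a = 1.

Definition equidivisible (S : monoidType) : Prop :=
  forall a b c d : S, a * b = c * d ->
    (exists u : S, a = c * u /\ d = u * b) \/
    (exists v : S, c = a * v /\ b = v * d).

Definition length_function (S : monoidType) (lambda : S -> nat) : Prop :=
  [/\ lambda 1 = 0%N,
      forall a b : S, lambda (a * b) = (lambda a + lambda b)%N
    & forall a : S, lambda a = 0%N <-> invertible a].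

Definition levi_monoid (S : monoidType) (lambda : S -> nat) : Prop :=
  [/\ equidivisible S, length_function lambda & exists a : S, ~ invertible a].

Definition left_cancellative (S : monoidType) : Prop :=
  forall a b c : S, a * b = a * c -> b = c.

Definition right_cancellative (S : monoidType) : Prop :=
  forall a b c : S, b * a = c * a -> b = c.

Definition left_rees_monoid (S : monoidType) (lambda : S -> nat) : Prop :=
  levi_monoid lambda /\ left_cancellative S.

Definition rees_monoid (S : monoidType) (lambda : S -> nat) : Prop :=
  [/\ levi_monoid lambda, left_cancellative S & right_cancellative S].

Definition atom (S : monoidType) (a : S) : Prop :=
  ~ invertible a /\
  (forall b c : S, a = b * c -> invertible b \/ invertible c).

Definition irreducible_monoid (S : monoidType) : Prop :=
  forall x y : S, atom x -> atom y ->
    exists g h : S, [/\ invertible g, invertible h & y = g * x * h].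

(* The embedding iota identifies G with the group of units of S. *)
Definition group_of_units (G : groupType) (S : monoidType) (iota : G -> S) :
    Prop :=
  [/\ monoid_morphism iota, injective iota
    & forall a : S, invertible a <-> exists g : G, iota g = a].

Definition monoid_isomorphic (S T : monoidType) : Prop :=
  exists2 f : S -> T, monoid_morphism f & bijective f.

Definition subgroup_type (G : groupType) (H : groupClosed G) : Type :=
  {x : G | x \in H}.

Section SubgroupType.
Variables (G : groupType) (H : groupClosed G).

HB.instance Definition _ := SubChoice.on (subgroup_type H).

Fact subgroup_type_closed : group_closed [in H].
Proof. by split; [exact: gpred1 | exact: gpredF]. Qed.

HB.instance Definition _ :=
  SubChoice_isSubGroup.Build G [in H] (subgroup_type H) subgroup_type_closed.

End SubgroupType.

HB.mixin Record isConjClosed (G : groupType) (N : {pred G}) := {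
  gpred_conj : forall x g : G, x \in N -> x ^ g \in N
}.

#[short(type="normalClosed")]
HB.structure Definition NormalClosed (G : groupType) :=
  {N of GroupClosed G N & isConjClosed G N}.

Section QuotientGroup.
Variables (G : groupType) (N : normalClosed G).
Implicit Types x y : G.

Definition coset_rel : rel G := fun x y => x^-1 * y \in N.

Fact coset_rel_refl : reflexive coset_rel.
Proof. by move=> x; rewrite /coset_rel mulVg gpred1. Qed.

Fact coset_rel_sym : symmetric coset_rel.
Proof. by move=> x y; rewrite /coset_rel -gpredV invgM invgK. Qed.

Fact coset_rel_trans : transitive coset_rel.
Proof.
move=> y x z xy yz; rewrite /coset_rel.
have -> : x^-1 * z = (x^-1 * y) * (y^-1 * z) by rewrite mulgA mulgK.
exact: gpredM.
Qed.

Canonical coset_equiv :=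
  EquivRel coset_rel coset_rel_refl coset_rel_sym coset_rel_trans.

Definition quotient_group : Type := {eq_quot coset_equiv}.
HB.instance Definition _ := Choice.on quotient_group.
HB.instance Definition _ := EqQuotient.on quotient_group.

Definition coset (x : G) : quotient_group := \pi_quotient_group x.

Definition quotient_mul (a b : quotient_group) : quotient_group :=
  coset (repr a * repr b).
Definition quotient_inv (a : quotient_group) : quotient_group :=
  coset (repr a)^-1.

Fact coset_eqP x y : coset x = coset y <-> x^-1 * y \in N.
Proof. by split=> [/eqmodP | ?]; last exact/eqmodP. Qed.

Fact coset_reprK (a : quotient_group) : coset (repr a) = a.
Proof. exact: reprK. Qed.

Fact quotient_mulE x y : quotient_mul (coset x) (coset y) = coset (x * y).
Proof.
have /coset_eqP hx := coset_reprK (coset x).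
have /coset_eqP hy := coset_reprK (coset y).
rewrite /quotient_mul; apply/coset_eqP.
set u := repr _ in hx *; set v := repr _ in hy *.
have -> : (u * v)^-1 * (x * y) = (u^-1 * x) ^ v * (v^-1 * y).
  by rewrite /conjg invgM !mulgA mulgK.
by rewrite gpredM// gpred_conj.
Qed.

Fact quotient_invE x : quotient_inv (coset x) = coset x^-1.
Proof.
have /coset_eqP hx := coset_reprK (coset x).
rewrite /quotient_inv; apply/coset_eqP; set u := repr _ in hx *.
rewrite invgK -gpredV invgM invgK.
have -> : x * u^-1 = (u^-1 * x) ^ (u^-1).
  by rewrite /conjg invgK !mulgA mulgV mul1g.
exact: gpred_conj.
Qed.

Fact quotient_mulA : associative quotient_mul.
Proof.
move=> a b c; rewrite -[a]coset_reprK -[b]coset_reprK -[c]coset_reprK.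
by rewrite !quotient_mulE mulgA.
Qed.

Fact quotient_mul1 : left_id (coset 1) quotient_mul.
Proof. by move=> a; rewrite -[a]coset_reprK quotient_mulE mul1g. Qed.

Fact quotient_mul_1 : right_id (coset 1) quotient_mul.
Proof. by move=> a; rewrite -[a]coset_reprK quotient_mulE mulg1. Qed.

Fact quotient_mulV : left_inverse (coset 1) quotient_inv quotient_mul.
Proof.
by move=> a; rewrite -[a]coset_reprK quotient_invE quotient_mulE mulVg.
Qed.

Fact quotient_mul_V : right_inverse (coset 1) quotient_inv quotient_mul.
Proof.
by move=> a; rewrite -[a]coset_reprK quotient_invE quotient_mulE mulgV.
Qed.

HB.instance Definition _ := isGroup.Build quotient_group
  quotient_mulA quotient_mul1 quotient_mul_1 quotient_mulV quotient_mul_V.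

Fact cosetM x y : coset (x * y) = coset x * coset y.
Proof. by rewrite -quotient_mulE. Qed.

Fact cosetV x : coset x^-1 = (coset x)^-1.
Proof. by rewrite -quotient_invE. Qed.

End QuotientGroup.

HB.mixin Record isBimodule (G : groupType) (X : Type) := {
  lact : G -> X -> X;
  ract : X -> G -> X;
  lact1 : forall x, lact 1 x = x;
  lactM : forall g h x, lact (g * h) x = lact g (lact h x);
  ract1 : forall x, ract x 1 = x;
  ractM : forall x g h, ract x (g * h) = ract (ract x g) h;
  lractA : forall g x h, ract (lact g x) h = lact g (ract x h);
  bimodule_inhabited : inhabited X
}.

#[short(type="bimodType")]
HB.structure Definition Bimodule (G : groupType) :=
  {X of isBimodule G X & Choice X}.

Section Xbar.
Variables (G : groupType) (H : groupClosed G) (gamma : groupClosed (G * G)%type)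
  (K : groupClosed G).

(* No condition relating gamma to H and K is needed for this to define a
   bimodule; the relations gamma used below are contained in H * K and project
   onto H and K (quotient_relation_subdirect, graph_relation_subdirect). *)
Definition xbar_rel : rel (G * G) := fun p q =>
  [&& q.1^-1 * p.1 \in H, q.2 * p.2^-1 \in K
    & (q.1^-1 * p.1, q.2 * p.2^-1) \in gamma].

Fact xbar_rel_refl : reflexive xbar_rel.
Proof. by move=> p; rewrite /xbar_rel mulVg mulgV !gpred1. Qed.

Fact xbar_rel_sym : symmetric xbar_rel.
Proof.
move=> p q; rewrite /xbar_rel.
have e1 : q.1^-1 * p.1 = (p.1^-1 * q.1)^-1 by rewrite invgM invgK.
have e2 : q.2 * p.2^-1 = (p.2 * q.2^-1)^-1 by rewrite invgM invgK.
rewrite e1 e2 !gpredV; congr [&& _, _ & _].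
exact: (gpredV gamma (p.1^-1 * q.1, p.2 * q.2^-1)).
Qed.

Fact xbar_rel_trans : transitive xbar_rel.
Proof.
move=> q p r /and3P[pq1 pq2 pq] /and3P[qr1 qr2 qr]; rewrite /xbar_rel.
have e1 : r.1^-1 * p.1 = (r.1^-1 * q.1) * (q.1^-1 * p.1).
  by rewrite mulgA mulgK.
have e2 : r.2 * p.2^-1 = (r.2 * q.2^-1) * (q.2 * p.2^-1).
  by rewrite mulgA mulgVK.
rewrite e1 e2; apply/and3P; split; [exact: gpredM | exact: gpredM |].
exact: (gpredM _ _ qr pq).
Qed.

Canonical xbar_equiv :=
  EquivRel xbar_rel xbar_rel_refl xbar_rel_sym xbar_rel_trans.

Definition Xbar : Type := {eq_quot xbar_equiv}.
HB.instance Definition _ := Choice.on Xbar.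
HB.instance Definition _ := EqQuotient.on Xbar.

Definition xbar_class (g h : G) : Xbar := \pi_Xbar (g, h).

Definition xbar_lact (g : G) (c : Xbar) : Xbar :=
  xbar_class (g * (repr c).1) (repr c).2.
Definition xbar_ract (c : Xbar) (g : G) : Xbar :=
  xbar_class (repr c).1 ((repr c).2 * g).

Fact xbar_eqP g1 h1 g2 h2 :
  xbar_class g1 h1 = xbar_class g2 h2 <-> xbar_rel (g1, h1) (g2, h2).
Proof. by split=> [/eqmodP | ?]; last exact/eqmodP. Qed.

Fact xbar_reprK (c : Xbar) : xbar_class (repr c).1 (repr c).2 = c.
Proof. by rewrite /xbar_class -surjective_pairing; exact: reprK. Qed.

Fact xbar_lactE g g1 h1 :
  xbar_lact g (xbar_class g1 h1) = xbar_class (g * g1) h1.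
Proof.
have /xbar_eqP := xbar_reprK (xbar_class g1 h1); set p := repr _ => e.
apply/xbar_eqP; move: e; rewrite -/p /xbar_rel /=.
by rewrite invgM -mulgA (mulgA g^-1) mulVg mul1g.
Qed.

Fact xbar_ractE g1 h1 g :
  xbar_ract (xbar_class g1 h1) g = xbar_class g1 (h1 * g).
Proof.
have /xbar_eqP := xbar_reprK (xbar_class g1 h1); set p := repr _ => e.
apply/xbar_eqP; move: e; rewrite -/p /xbar_rel /=.
by rewrite invgM mulgA mulgK.
Qed.

Fact xbar_lact1 c : xbar_lact 1 c = c.
Proof. by rewrite -[c]xbar_reprK xbar_lactE mul1g. Qed.

Fact xbar_lactM g h c : xbar_lact (g * h) c = xbar_lact g (xbar_lact h c).
Proof. by rewrite -[c]xbar_reprK !xbar_lactE mulgA. Qed.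

Fact xbar_ract1 c : xbar_ract c 1 = c.
Proof. by rewrite -[c]xbar_reprK xbar_ractE mulg1. Qed.

Fact xbar_ractM c g h : xbar_ract c (g * h) = xbar_ract (xbar_ract c g) h.
Proof. by rewrite -[c]xbar_reprK !xbar_ractE mulgA. Qed.

Fact xbar_lractA g c h :
  xbar_ract (xbar_lact g c) h = xbar_lact g (xbar_ract c h).
Proof. by rewrite -[c]xbar_reprK xbar_lactE !xbar_ractE xbar_lactE. Qed.

HB.instance Definition _ := isBimodule.Build G Xbar
  xbar_lact1 xbar_lactM xbar_ract1 xbar_ractM xbar_lractA
  (inhabits (xbar_class 1 1)).

End Xbar.

Section TensorMonoid.
Variables (G : groupType) (X : bimodType G).
Implicit Types (g h : G) (x y : X) (s t : seq X).

(* For s = [:: x_1; ...; x_n] and t = [:: y_1; ...; y_n]: there are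
   g_0, ..., g_n with g_0 = a, g_n = b and y_i = g_(i-1)^-1 x_i g_i.
   At a = b = 1 this is the equality of x_1 (x) ... (x) x_n and
   y_1 (x) ... (x) y_n (and reduces to x_1 = y_1 when n = 1). *)
Definition tensor_chain (a : G) s t (b : G) : Prop :=
  size s = size t /\
  exists g : nat -> G, [/\ g 0%N = a, g (size s) = b
    & forall x0 i, (i < size s)%N ->
        nth x0 t i = lact (g i)^-1 (ract (nth x0 s i) (g i.+1))].

(* inl g is g in G; inr (x, s) is the nonempty sequence x :: s, which stands
   for a tensor of degree (size s).+1. *)
Definition tensor_word : Type := (G + X * seq X)%type.
HB.instance Definition _ := Choice.on tensor_word.

(* Words of different degrees are never related, so that the quotient is the
   disjoint union of G and of the tensor powers of X. *)
Definition tensor_word_eq (v w : tensor_word) : Prop :=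
  match v, w with
  | inl g, inl h => g = h
  | inr (x, s), inr (y, t) => tensor_chain 1 (x :: s) (y :: t) 1
  | _, _ => False
  end.

Fixpoint ract_last x s h : X * seq X :=
  if s is y :: s' then let: (z, t) := ract_last y s' h in (x, z :: t)
  else (ract x h, [::]).

Definition tensor_word_mul (v w : tensor_word) : tensor_word :=
  match v, w with
  | inl g, inl h => inl (g * h)
  | inl g, inr (x, s) => inr (lact g x, s)
  | inr (x, s), inl h => inr (ract_last x s h)
  | inr (x, s), inr (y, t) => inr (x, s ++ y :: t)
  end.

Fact tensor_chain_nil : tensor_chain 1 [::] [::] 1.
Proof. by split=> //; exists (fun=> 1); split. Qed.

Fact tensor_chain_cons a x s y t b :
  tensor_chain a (x :: s) (y :: t) b <->
  exists c, y = lact a^-1 (ract x c) /\ tensor_chain c s t b.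
Proof.
split=> [[/= [sz] [g [g0 gn gP]]] | [c [-> [sz [g [g0 gn gP]]]]]].
  exists (g 1%N); split; first by rewrite -g0; exact: (gP x 0%N).
  split=> //; exists (fun i => g i.+1); split=> // x0 i lti.
  exact: (gP x0 i.+1).
split; first by rewrite /= sz.
exists (fun i => if i is j.+1 then g j else a); split=> // x0 [|i] //=.
  by rewrite g0.
exact: gP.
Qed.

Fact tensor_chain_nilE a b : tensor_chain a [::] [::] b <-> a = b.
Proof.
split=> [[_ [g [<- <- _]]] // | ->].
by split=> //; exists (fun=> b); split.
Qed.

Fact tensor_chain_refl s : tensor_chain 1 s s 1.
Proof.
elim: s => [|x s IHs]; first exact: tensor_chain_nil.
by apply/tensor_chain_cons; exists 1; rewrite invg1 lact1 ract1.
Qed.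

Fact tensor_chain_sym a s t b :
  tensor_chain a s t b -> tensor_chain a^-1 t s b^-1.
Proof.
elim: s t a => [|x s IHs] [|y t] a; try by case.
  by move=> /tensor_chain_nilE ->; apply/tensor_chain_nilE.
move=> /tensor_chain_cons[c [-> /IHs st]]; apply/tensor_chain_cons.
exists c^-1; split=> //.
by rewrite invgK lractA -ractM mulgV ract1 -lactM mulgV lact1.
Qed.

Fact tensor_chain_trans a a' s t u b b' :
  tensor_chain a s t b -> tensor_chain a' t u b' ->
  tensor_chain (a * a') s u (b * b').
Proof.
elim: s t u a a' => [|x s IHs] [|y t] [|z u] a a'; try by [case|move=> _; case].
  by move=> /tensor_chain_nilE -> /tensor_chain_nilE ->; apply/tensor_chain_nilE.
move=> /tensor_chain_cons[c [-> st]] /tensor_chain_cons[d [-> tu]].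
apply/tensor_chain_cons; exists (c * d); split; last exact: IHs st tu.
by rewrite lractA -lactM -ractM invgM.
Qed.

Fact tensor_chain_cat a s t b s' t' c :
  tensor_chain a s t b -> tensor_chain b s' t' c ->
  tensor_chain a (s ++ s') (t ++ t') c.
Proof.
elim: s t a => [|x s IHs] [|y t] a; try by case.
  by move=> /tensor_chain_nilE ->.
move=> /tensor_chain_cons[d [-> st]] st'; apply/tensor_chain_cons.
by exists d; split=> //; exact: IHs st st'.
Qed.

Fact ract_lastE x s h :
  (ract_last x s h).1 :: (ract_last x s h).2
    = rcons (belast x s) (ract (last x s) h).
Proof.
elim: s x => [|y s IHs] x //=.
by move: (IHs y); case: ract_last => z t /= ->.
Qed.

Fact tensor_chain_ract_last x s h :
  tensor_chain 1 (x :: s) ((ract_last x s h).1 :: (ract_last x s h).2) h.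
Proof.
rewrite ract_lastE lastI -!cats1.
apply: tensor_chain_cat (tensor_chain_refl _) _.
apply/tensor_chain_cons; exists h; split; last exact/tensor_chain_nilE.
by rewrite invg1 lact1.
Qed.

Fact tensor_chain_lact a x s y t b g :
  tensor_chain a (x :: s) (y :: t) b ->
  tensor_chain (g * a) (lact g x :: s) (y :: t) b.
Proof.
move=> /tensor_chain_cons[c [-> st]]; apply/tensor_chain_cons.
by exists c; split=> //; rewrite lractA -lactM invgM mulgVK.
Qed.

Fact tensor_word_eq_refl v : tensor_word_eq v v.
Proof. by case: v => [//|[x s]]; exact: tensor_chain_refl. Qed.

Fact tensor_word_eq_sym v w : tensor_word_eq v w -> tensor_word_eq w v.
Proof.
case: v w => [g|[x s]] [h|[y t]] //=.
by move=> /tensor_chain_sym; rewrite invg1.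
Qed.

Fact tensor_word_eq_trans v w u :
  tensor_word_eq v w -> tensor_word_eq w u -> tensor_word_eq v u.
Proof.
case: v w u => [g|[x s]] [h|[y t]] [k|[z r]] //=; first by move=> ->.
by move=> xy yz; have := tensor_chain_trans xy yz; rewrite mulg1.
Qed.

Fact tensor_word_mul_eq v v' w w' :
  tensor_word_eq v v' -> tensor_word_eq w w' ->
  tensor_word_eq (tensor_word_mul v w) (tensor_word_mul v' w').
Proof.
case: v v' w w' => [g|[x s]] [g'|[x' s']] [h|[y t]] [h'|[y' t']] //=.
- by move=> -> ->.
- move=> -> yt.
  have h1 := tensor_chain_lact g' yt.
  have /(tensor_chain_lact g')/tensor_chain_sym h2 := tensor_chain_refl (y' :: t').
  by have := tensor_chain_trans h1 h2; rewrite mulg1 mulgV invg1 mulg1.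
- move=> xs ->.
  have h1 := tensor_chain_ract_last x' s' h'.
  have /tensor_chain_sym h2 := tensor_chain_ract_last x s h'.
  have := tensor_chain_trans h2 (tensor_chain_trans xs h1).
  rewrite invg1 !mul1g mulVg.
  by case: (ract_last x s h') => ? ?; case: (ract_last x' s' h').
- by move=> xs yt; exact: (tensor_chain_cat xs yt).
Qed.

Fact tensor_word_mulA u v w :
  tensor_word_eq (tensor_word_mul u (tensor_word_mul v w))
                 (tensor_word_mul (tensor_word_mul u v) w).
Proof.
case: u v w => [g|[x s]] [h|[y t]] [k|[z r]] /=.
- by rewrite mulgA.
- by rewrite lactM; exact: tensor_chain_refl.
- case: t => [|y' t] /=; first by rewrite lractA; exact: tensor_chain_refl.
  by case: ract_last => z r; exact: tensor_chain_refl.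
- exact: tensor_chain_refl.
- have h1 := tensor_chain_ract_last x s (h * k).
  have h2 := tensor_chain_ract_last x s h.
  case: (ract_last x s h) h2 => x1 s1 /= h2.
  have h3 := tensor_chain_ract_last x1 s1 k.
  have := tensor_chain_trans (tensor_chain_sym h1) (tensor_chain_trans h2 h3).
  rewrite invg1 !mul1g mulVg.
  by case: (ract_last x s (h * k)) => ? ?; case: (ract_last x1 s1 k).
- have := tensor_chain_ract_last x s h.
  case: ract_last => x1 s1 /= xs.
  suff zr : tensor_chain h (lact h z :: r) (z :: r) 1.
    exact: (tensor_chain_cat xs zr).
  by have := tensor_chain_lact h (tensor_chain_refl (z :: r)); rewrite mulg1.
- have -> : ract_last x (s ++ y :: t) k =
            (x, s ++ (ract_last y t k).1 :: (ract_last y t k).2).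
    elim: s x => [|x' s IHs] x /=; first by case: ract_last.
    by rewrite IHs.
  by case: ract_last => ? ?; exact: tensor_chain_refl.
- by rewrite -catA; exact: tensor_chain_refl.
Qed.

Fact tensor_word_mul1 v : tensor_word_mul (inl 1) v = v.
Proof. by case: v => [g|[x s]] /=; rewrite ?mul1g ?lact1. Qed.

Fact tensor_word_mul_1 v : tensor_word_mul v (inl 1) = v.
Proof.
case: v => [g|[x s]] /=; rewrite ?mulg1//; congr inr.
by elim: s x => [|y s IHs] x /=; rewrite ?ract1// IHs.
Qed.

Definition tensor_rel : rel tensor_word := fun v w => `[< tensor_word_eq v w >].

Fact tensor_rel_refl : reflexive tensor_rel.
Proof. by move=> v; exact/asboolP/tensor_word_eq_refl. Qed.

Fact tensor_rel_sym : symmetric tensor_rel.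
Proof. by move=> v w; apply/asboolP/asboolP; exact: tensor_word_eq_sym. Qed.

Fact tensor_rel_trans : transitive tensor_rel.
Proof.
move=> w v u /asboolP vw /asboolP wu; apply/asboolP.
exact: tensor_word_eq_trans vw wu.
Qed.

Canonical tensor_equiv :=
  EquivRel tensor_rel tensor_rel_refl tensor_rel_sym tensor_rel_trans.

Definition tensor_monoid : Type := {eq_quot tensor_equiv}.
HB.instance Definition _ := Choice.on tensor_monoid.
HB.instance Definition _ := EqQuotient.on tensor_monoid.

Definition tensor_class (v : tensor_word) : tensor_monoid := \pi_tensor_monoid v.

Definition tensor_mul (a b : tensor_monoid) : tensor_monoid :=
  tensor_class (tensor_word_mul (repr a) (repr b)).

Fact tensor_eqP v w : tensor_class v = tensor_class w <-> tensor_word_eq v w.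
Proof.
by split=> [/eqmodP/asboolP | ?]; last by apply/eqmodP/asboolP.
Qed.

Fact tensor_reprK (a : tensor_monoid) : tensor_class (repr a) = a.
Proof. exact: reprK. Qed.

Fact tensor_mulE v w :
  tensor_mul (tensor_class v) (tensor_class w)
    = tensor_class (tensor_word_mul v w).
Proof.
by apply/tensor_eqP/tensor_word_mul_eq; apply/tensor_eqP/tensor_reprK.
Qed.

Fact tensor_mulA : associative tensor_mul.
Proof.
move=> a b c; rewrite -[a]tensor_reprK -[b]tensor_reprK -[c]tensor_reprK.
by rewrite !tensor_mulE; exact/tensor_eqP/tensor_word_mulA.
Qed.

Fact tensor_mul1 : left_id (tensor_class (inl 1)) tensor_mul.
Proof. by move=> a; rewrite -[a]tensor_reprK tensor_mulE tensor_word_mul1. Qed.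

Fact tensor_mul_1 : right_id (tensor_class (inl 1)) tensor_mul.
Proof. by move=> a; rewrite -[a]tensor_reprK tensor_mulE tensor_word_mul_1. Qed.

HB.instance Definition _ :=
  isMonoid.Build tensor_monoid tensor_mulA tensor_mul1 tensor_mul_1.

End TensorMonoid.

Definition subdirect (G : groupType) (H K : groupClosed G)
    (gamma : {pred G * G}) : Prop :=
  [/\ forall h k, (h, k) \in gamma -> h \in H /\ k \in K,
      forall h, h \in H -> exists k, (h, k) \in gamma
    & forall k, k \in K -> exists h, (h, k) \in gamma].

Section QuotientRelation.
Variables (G : groupType) (H K : groupClosed G).
Variables (NH : normalClosed (subgroup_type H)).
Variables (NK : normalClosed (subgroup_type K)).
Variable theta : UMagmaMorphism.type (quotient_group NH) (quotient_group NK).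

Definition quotient_relation : {pred G * G} := fun p =>
  `[< exists (h : subgroup_type H) (k : subgroup_type K),
        p = (val h, val k) /\ theta (coset NH h) = coset NK k >].

Fact quotient_relation_mul : mulg_closed quotient_relation.
Proof.
move=> _ _ /asboolP[h [k [-> e]]] /asboolP[h' [k' [-> e']]]; apply/asboolP.
exists (h * h'), (k * k'); split; first by rewrite !valM.
by rewrite !cosetM gmulfM e e'.
Qed.

Fact quotient_relation_1 : 1 \in quotient_relation.
Proof.
apply/asboolP; exists 1, 1; split=> //.
exact: gmulf1.
Qed.

Fact quotient_relation_inv : invg_closed quotient_relation.
Proof.
move=> _ /asboolP[h [k [-> e]]]; apply/asboolP.
by exists h^-1, k^-1; split=> //; rewrite !cosetV gmulfV e.
Qed.

HB.instance Definition _ :=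
  isMulClosed.Build (G * G)%type quotient_relation quotient_relation_mul.
HB.instance Definition _ :=
  isMul1Closed.Build (G * G)%type quotient_relation quotient_relation_1.
HB.instance Definition _ :=
  isInvClosed.Build (G * G)%type quotient_relation quotient_relation_inv.

Fact quotient_relation_subdirect :
  bijective theta -> subdirect H K quotient_relation.
Proof.
move=> [theta' _ thetaK']; split.
- by move=> h k /asboolP[h' [k' [[-> ->] _]]]; split; exact: valP.
- move=> h hH; pose h' : subgroup_type H := Sub h hH.
  exists (val (repr (theta (coset NH h')))); apply/asboolP.
  by exists h', (repr (theta (coset NH h'))); rewrite SubK coset_reprK.
- move=> k kK; pose k' : subgroup_type K := Sub k kK.
  exists (val (repr (theta' (coset NK k')))); apply/asboolP.
  by exists (repr (theta' (coset NK k'))), k'; rewrite SubK coset_reprK.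
Qed.

End QuotientRelation.

Section GraphRelation.
Variables (G : groupType) (H K : groupClosed G).
Variable phi : UMagmaMorphism.type (subgroup_type H) (subgroup_type K).

Definition graph_relation : {pred G * G} := fun p =>
  `[< exists h : subgroup_type H, p = (val h, val (phi h)) >].

Fact graph_relation_mul : mulg_closed graph_relation.
Proof.
move=> _ _ /asboolP[h ->] /asboolP[h' ->]; apply/asboolP.
by exists (h * h'); rewrite !gmulfM.
Qed.

Fact graph_relation_1 : 1 \in graph_relation.
Proof. by apply/asboolP; exists 1; rewrite !gmulf1. Qed.

Fact graph_relation_inv : invg_closed graph_relation.
Proof.
move=> _ /asboolP[h ->]; apply/asboolP; exists h^-1.
by rewrite !gmulfV.
Qed.

HB.instance Definition _ :=
  isMulClosed.Build (G * G)%type graph_relation graph_relation_mul.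
HB.instance Definition _ :=
  isMul1Closed.Build (G * G)%type graph_relation graph_relation_1.
HB.instance Definition _ :=
  isInvClosed.Build (G * G)%type graph_relation graph_relation_inv.

Fact graph_relation_subdirect :
  (forall k, exists h, phi h = k) -> subdirect H K graph_relation.
Proof.
move=> phi_surj; split.
- by move=> h k /asboolP[h' [-> ->]]; split; exact: valP.
- move=> h hH; pose h' : subgroup_type H := Sub h hH.
  by exists (val (phi h')); apply/asboolP; exists h'; rewrite SubK.
- move=> k kK; have [h hk] := phi_surj (Sub k kK).
  by exists (val h); apply/asboolP; exists h; rewrite hk SubK.
Qed.

End GraphRelation.

(* Main.v *)
(* Fix an atom x of S and let gamma = {(h, k) | h x = x k}, a subgroup of G * G.
   By irreducibility the atoms are the elements g x h, and g x h = g' x h' iff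
   (g'^-1 g, h' h^-1) is in gamma, so the bimodule of atoms is Xbar(H, gamma, K)
   for the two projections H and K of gamma.  By the length function every
   non-unit is a product of atoms, and by equidivisibility such a product is
   unique up to moving units between neighbouring factors, i.e. S is the tensor
   monoid of its atoms.  Goursat's lemma turns gamma into an isomorphism of
   divisors; left cancellativity makes gamma the graph of a map, which is
   injective if S is also right cancellative. *)

Require Import Defs.
From HB Require Import structures.
From mathcomp Require Import all_boot.
From mathcomp Require Import boolp.

Set Implicit Arguments.
Unset Strict Implicit.
Unset Printing Implicit Defensive.

Local Open Scope group_scope.

(** * Goursat's lemma for a subgroup of [G * G] *)

Section Goursat.
Variables (G : groupType) (gamma : groupClosed (G * G)%type).
Implicit Types g h k : G.

Lemma relM h k h' k' :
  (h, k) \in gamma -> (h', k') \in gamma -> (h * h', k * k') \in gamma.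
Proof. exact: gpredM. Qed.

Lemma rel1 : (1, 1) \in gamma.
Proof. exact: gpred1. Qed.

Lemma relV h k : (h, k) \in gamma -> (h^-1, k^-1) \in gamma.
Proof. by move=> hk; rewrite -gpredV in hk. Qed.

Definition rel_dom : {pred G} := fun h => `[< exists k, (h, k) \in gamma >].
Definition rel_cod : {pred G} := fun k => `[< exists h, (h, k) \in gamma >].

Fact rel_dom_mul : mulg_closed rel_dom.
Proof.
move=> h h' /asboolP[k hk] /asboolP[k' hk']; apply/asboolP.
by exists (k * k'); exact: relM.
Qed.

Fact rel_dom_1 : 1 \in rel_dom.
Proof. by apply/asboolP; exists 1; exact: rel1. Qed.

Fact rel_dom_inv : invg_closed rel_dom.
Proof. by move=> h /asboolP[k /relV hk]; apply/asboolP; exists k^-1. Qed.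

HB.instance Definition _ := isMulClosed.Build G rel_dom rel_dom_mul.
HB.instance Definition _ := isMul1Closed.Build G rel_dom rel_dom_1.
HB.instance Definition _ := isInvClosed.Build G rel_dom rel_dom_inv.

Fact rel_cod_mul : mulg_closed rel_cod.
Proof.
move=> k k' /asboolP[h hk] /asboolP[h' hk']; apply/asboolP.
by exists (h * h'); exact: relM.
Qed.

Fact rel_cod_1 : 1 \in rel_cod.
Proof. by apply/asboolP; exists 1; exact: rel1. Qed.

Fact rel_cod_inv : invg_closed rel_cod.
Proof. by move=> k /asboolP[h /relV hk]; apply/asboolP; exists h^-1. Qed.

HB.instance Definition _ := isMulClosed.Build G rel_cod rel_cod_mul.
HB.instance Definition _ := isMul1Closed.Build G rel_cod rel_cod_1.
HB.instance Definition _ := isInvClosed.Build G rel_cod rel_cod_inv.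

Local Notation H := (subgroup_type rel_dom).
Local Notation K := (subgroup_type rel_cod).

Lemma exists_partner (h : H) : exists k : K, (val h, val k) \in gamma.
Proof.
have /asboolP[k hk] := valP h.
have kK : k \in rel_cod by apply/asboolP; exists (val h).
by exists (Sub k kK); rewrite SubK.
Qed.

(** An arbitrary choice in the fibre over [h]: multiplicative only modulo [rel_kerr], unless the
    fibres are singletons. *)
Definition partner (h : H) : K := sval (cid (exists_partner h)).

Lemma partnerP (h : H) : (val h, val (partner h)) \in gamma.
Proof. exact: (svalP (cid (exists_partner h))). Qed.

Lemma rel_in h k :
  (h, k) \in gamma -> exists (h' : H) (k' : K), h = val h' /\ k = val k'.
Proof.
move=> hk; have hH : h \in rel_dom by apply/asboolP; exists k.
have kK : k \in rel_cod by apply/asboolP; exists h.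
by exists (Sub h hH), (Sub k kK); rewrite !SubK.
Qed.

Section Isomorphism.

Definition rel_kerl : {pred H} := fun h : H => (val h, 1) \in gamma.
Definition rel_kerr : {pred K} := fun k : K => (1, val k) \in gamma.

Fact rel_kerl_mul : mulg_closed rel_kerl.
Proof. by move=> h h' /relM hk /hk; rewrite mulg1 -valM. Qed.

Fact rel_kerl_1 : 1 \in rel_kerl.
Proof. exact: rel1. Qed.

Fact rel_kerl_inv : invg_closed rel_kerl.
Proof. by move=> h /relV; rewrite invg1. Qed.

(** Conjugating [(h, 1)] by [(g, partner g)] stays in [gamma] and leaves the second component
    trivial. *)
Fact rel_kerl_conj (h g : H) : h \in rel_kerl -> h ^ g \in rel_kerl.
Proof.
move=> hN; have gP := partnerP g.
have := relM (relV gP) (relM hN gP).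
by rewrite mul1g mulVg.
Qed.

HB.instance Definition _ := isMulClosed.Build H rel_kerl rel_kerl_mul.
HB.instance Definition _ := isMul1Closed.Build H rel_kerl rel_kerl_1.
HB.instance Definition _ := isInvClosed.Build H rel_kerl rel_kerl_inv.
HB.instance Definition _ := isConjClosed.Build H rel_kerl rel_kerl_conj.

Fact rel_kerr_mul : mulg_closed rel_kerr.
Proof. by move=> k k' /relM hk /hk; rewrite mulg1 -valM. Qed.

Fact rel_kerr_1 : 1 \in rel_kerr.
Proof. exact: rel1. Qed.

Fact rel_kerr_inv : invg_closed rel_kerr.
Proof. by move=> k /relV; rewrite invg1. Qed.

Fact rel_kerr_conj (k g : K) : k \in rel_kerr -> k ^ g \in rel_kerr.
Proof.
move=> kN; have /asboolP[h hg] := valP g.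
have := relM (relV hg) (relM kN hg).
by rewrite mul1g mulVg.
Qed.

HB.instance Definition _ := isMulClosed.Build K rel_kerr rel_kerr_mul.
HB.instance Definition _ := isMul1Closed.Build K rel_kerr rel_kerr_1.
HB.instance Definition _ := isInvClosed.Build K rel_kerr rel_kerr_inv.
HB.instance Definition _ := isConjClosed.Build K rel_kerr rel_kerr_conj.

Definition rel_theta (a : quotient_group rel_kerl) : quotient_group rel_kerr :=
  coset rel_kerr (partner (repr a)).

(** Changing [h] within its coset multiplies a pair by some [(n, 1)] in [gamma], and changing the
    partner by some [(1, m)], so the choices made in [rel_theta] do not matter. That it is an
    isomorphism is read off from here. *)
Lemma rel_thetaP (h : H) (k : K) :
  rel_theta (coset rel_kerl h) = coset rel_kerr k <-> (val h, val k) \in gamma.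
Proof.
rewrite /rel_theta; have /coset_eqP := coset_reprK (coset rel_kerl h).
set h' := repr _ => hh'; have h'P := partnerP h'.
have {}hh' : ((val h')^-1 * val h, 1) \in gamma := hh'.
rewrite coset_eqP; split=> [kk'|hk].
  have {}kk' : (1, (val (partner h'))^-1 * val k) \in gamma := kk'.
  have := relM h'P (relM hh' kk').
  by rewrite mulg1 mul1g !mulgA !mulgV !mul1g.
have := relM (relV hh') (relM (relV h'P) hk).
by rewrite invg1 mul1g invgM invgK mulgA mulgK mulVg.
Qed.

Fact rel_theta_monoid_morphism : monoid_morphism rel_theta.
Proof.
split=> [|a b]; first by apply/rel_thetaP; exact: rel1.
rewrite -[a]coset_reprK -[b]coset_reprK -cosetM.
(* Both factors are cosets of partners, and a product of pairs in [gamma] is in [gamma]. *)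
rewrite [rel_theta _ * _](_ : _ =
    coset rel_kerr (partner (repr a) * partner (repr b))).
  by apply/rel_thetaP; rewrite !valM; apply: relM; exact: partnerP.
by rewrite cosetM; congr (_ * _); apply/rel_thetaP; exact: partnerP.
Qed.

HB.instance Definition _ := isUMagmaMorphism.Build _ _ rel_theta
  rel_theta_monoid_morphism.

Lemma rel_theta_bij : bijective rel_theta.
Proof.
have /choice[f fP] (b : quotient_group rel_kerr) : exists a, rel_theta a = b.
  rewrite -[b]coset_reprK; have /asboolP[h hk] := valP (repr b).
  have [h' [_ [hE _]]] := rel_in hk; rewrite hE in hk.
  by exists (coset rel_kerl h'); apply/rel_thetaP.
suff theta_inj : injective rel_theta.
  by exists f => // a; apply: theta_inj; rewrite fP.
move=> a b; rewrite -[a]coset_reprK -[b]coset_reprK.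
(* Equal images give [repr a] and [repr b] a common partner, so they differ by an element of
   [rel_kerl]. *)
have bP := partnerP (repr b); rewrite [RHS]((rel_thetaP _ _).2 bP).
move=> /rel_thetaP abP; apply/coset_eqP.
by have := relM (relV abP) bP; rewrite mulVg.
Qed.

Lemma quotient_relationP h k :
  (h, k) \in quotient_relation rel_theta <-> (h, k) \in gamma.
Proof.
split=> [/asboolP[h' [k' [[-> ->]]]] /rel_thetaP //|hk].
apply/asboolP; have [h' [k' [hE kE]]] := rel_in hk.
by exists h', k'; split; rewrite ?hE ?kE//; apply/rel_thetaP; rewrite -hE -kE.
Qed.

End Isomorphism.

Section Graph.
Hypothesis gamma_fun :
  forall h k k', (h, k) \in gamma -> (h, k') \in gamma -> k = k'.

Lemma partnerE (h : H) (k : K) : (val h, val k) \in gamma -> partner h = k.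
Proof. by move=> hk; apply/val_inj/(gamma_fun _ hk)/partnerP. Qed.

Lemma partner_monoid_morphism : monoid_morphism partner.
Proof.
split=> [|h h']; apply: partnerE; first exact: rel1.
by rewrite !valM; apply: relM; exact: partnerP.
Qed.

(** With singleton fibres the choice in [partner] is forced, hence multiplicative; it is onto
    because [rel_cod] is a projection of [gamma]. *)
Lemma functional_rel_graph :
  exists2 phi : UMagmaMorphism.type H K, (forall k : K, exists h : H, phi h = k)
    & forall h k, (h, k) \in graph_relation phi <-> (h, k) \in gamma.
Proof.
pose m := isUMagmaMorphism.Build H K partner partner_monoid_morphism.
pose phi : UMagmaMorphism.type H K := HB.pack partner m.
exists phi => [k|h k].
  have /asboolP[h hk] := valP k; have [h' [_ [hE _]]] := rel_in hk.
  by exists h'; apply: partnerE; rewrite -hE.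
split=> [/asboolP[h' [-> ->]]|hk]; first exact: partnerP.
apply/asboolP; have [h' [k' [hE kE]]] := rel_in hk; exists h'.
by rewrite hE kE; congr (_, val _); apply/esym/partnerE; rewrite -hE -kE.
Qed.

End Graph.
End Goursat.

(** * Unit cancellation and the pairs of units linked by an element *)

Section UnitAction.
Variables (G : groupType) (S : monoidType).
Variable iota : UMagmaMorphism.type G S.
Implicit Types (g : G) (a : S).

Lemma unitK g a : iota g^-1 * (iota g * a) = a.
Proof. by rewrite mulgA -gmulfM mulVg gmulf1 mul1g. Qed.

Lemma unitVK g a : iota g * (iota g^-1 * a) = a.
Proof. by rewrite mulgA -gmulfM mulgV gmulf1 mul1g. Qed.

End UnitAction.

Section Linking.
Variables (G : groupType) (S : monoidType).
Variables (iota : UMagmaMorphism.type G S) (x : S).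

(** The stabiliser of [x] when [(h, k)] acts on [S] by [a |-> iota h * a * iota k^-1]. *)
Definition linking : {pred G * G} := fun p => iota p.1 * x == x * iota p.2.

Lemma linkingP h k : (h, k) \in linking <-> iota h * x = x * iota k.
Proof. by split=> /eqP. Qed.

Lemma linking_fun : injective iota -> left_cancellative S ->
  forall h k k', (h, k) \in linking -> (h, k') \in linking -> k = k'.
Proof.
by move=> iota_inj S_lcancel h k k' /linkingP e /linkingP; rewrite e
  => /S_lcancel/iota_inj.
Qed.

Fact linking_mul : mulg_closed linking.
Proof.
move=> [h k] [h' k'] /linkingP e /linkingP e'; apply/linkingP.
by rewrite !gmulfM -mulgA e' mulgA e mulgA.
Qed.

Fact linking_1 : 1 \in linking.
Proof. by apply/linkingP; rewrite !gmulf1 mul1g mulg1. Qed.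

Fact linking_inv : invg_closed linking.
Proof.
move=> [h k] /linkingP e; apply/linkingP.
(* Inserting [k * k^-1] on the right makes [x * iota k] appear, which is traded for [iota h * x];
   then [iota h^-1] cancels. *)
by rewrite -[LHS]mulg1 -(gmulf1 (s := iota)) -(mulgV k) gmulfM mulgA
  -(mulgA _ x) -e unitK.
Qed.

HB.instance Definition _ := isMulClosed.Build (G * G)%type linking linking_mul.
HB.instance Definition _ := isMul1Closed.Build (G * G)%type linking linking_1.
HB.instance Definition _ := isInvClosed.Build (G * G)%type linking linking_inv.

End Linking.

(** Lets the isomorphism be built as evaluation out of the tensor monoid; the inverse of a bijective
    morphism is a morphism. *)
Lemma monoid_isomorphic_inv (S T : monoidType) (f : T -> S) :
  monoid_morphism f -> injective f -> (forall a, exists t, f t = a) ->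
  monoid_isomorphic S T.
Proof.
move=> [f1 fM] f_inj /choice[g gK]; exists g.
  by split=> [|a b]; apply: f_inj; rewrite ?fM !gK.
by exists f => // t; apply: f_inj; rewrite gK.
Qed.

(** * Length, units and atoms *)

Section Levi.
Variables (G : groupType) (S : monoidType) (lambda : S -> nat).
Variable iota : UMagmaMorphism.type G S.
Hypothesis S_length : length_function lambda.
Hypothesis iota_units : forall a, invertible a <-> exists g : G, iota g = a.
Implicit Types (a b x y : S) (g h k : G).

Lemma lengthM a b : lambda (a * b) = (lambda a + lambda b)%N.
Proof. by case: S_length. Qed.

Lemma length_eq0 a : lambda a = 0%N <-> invertible a.
Proof. by case: S_length. Qed.

Lemma length_unit g : lambda (iota g) = 0%N.
Proof. by apply/length_eq0/iota_units; exists g. Qed.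

Lemma length1 : lambda 1 = 0%N.
Proof. by case: S_length. Qed.

Lemma length_unitl g a : lambda (iota g * a) = lambda a.
Proof. by rewrite lengthM length_unit. Qed.

Lemma length_unitr a g : lambda (a * iota g) = lambda a.
Proof. by rewrite lengthM length_unit addn0. Qed.

Lemma length_gt0 a : ~ invertible a -> (0 < lambda a)%N.
Proof. by rewrite lt0n => a_nu; apply/eqP => /length_eq0. Qed.

(** Strong induction on length: a nonunit that is not an atom splits into two nonunits, both of
    positive length and hence both shorter. *)
Lemma mulg_nonunit_ind (P : S -> Prop) :
  (forall x, atom x -> P x) -> (forall a b, P a -> P b -> P (a * b)) ->
  forall a, ~ invertible a -> P a.
Proof.
move=> P_atom P_mul a; have [n] := ubnP (lambda a).
elim: n a => // n IHn a lt_an a_nu.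
have [/P_atom //|a_na] := pselect (atom a).
have [b [c [abc b_nu c_nu]]] :
    exists b c, [/\ a = b * c, ~ invertible b & ~ invertible c].
  apply: contrapT => a_irr; case: a_na; split=> // b c abc.
  by apply: contrapT => /not_orP[b_nu c_nu]; apply: a_irr; exists b, c.
move: lt_an; rewrite abc lengthM ltnS => le_n.
have b_gt0 := length_gt0 b_nu; have c_gt0 := length_gt0 c_nu.
apply: P_mul; apply: IHn => //; apply: leq_trans le_n.
  by rewrite -addn1 leq_add2l.
by rewrite -add1n leq_add2r.
Qed.

Lemma exists_atom : (exists a, ~ invertible a) -> exists x, atom x.
Proof.
by move=> [a]; apply: (mulg_nonunit_ind (P := fun=> exists x, atom x));
  first by move=> x; exists x.
Qed.

(** Moving the units across turns a factorization of [iota g * x * iota h] into one of [x]; unit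
    factors change neither length nor, therefore, invertibility. *)
Lemma atom_unitM g x h : atom x -> atom (iota g * x * iota h).
Proof.
move=> [x_nu x_irr]; split.
  by move=> /length_eq0; rewrite length_unitr length_unitl => /length_eq0.
move=> b c e; have /x_irr : x = (iota g^-1 * b) * (c * iota h^-1).
  by rewrite -mulgA (mulgA b) -e -!mulgA -gmulfM mulgV gmulf1 mulg1 unitK.
by rewrite -!length_eq0 length_unitl length_unitr.
Qed.

(** * Tensor presentation over a bimodule [X] identified by [v] with the atoms *)

Section Presentation.
Variables (X : bimodType G) (v : X -> S).
Hypothesis S_equidiv : equidivisible S.
Hypothesis iota_inj : injective iota.
Hypothesis v_lact : forall g c, v (lact g c) = iota g * v c.
Hypothesis v_ract : forall c g, v (ract c g) = v c * iota g.
Hypothesis v_inj : injective v.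
Hypothesis v_atom : forall x, atom x <-> exists c, v c = x.
Implicit Types (c d : X) (s t : seq X) (w : tensor_word X).

Definition seq_val s : S := foldr (fun c a => v c * a) 1 s.

Definition word_val w : S :=
  match w with inl g => iota g | inr (c, s) => seq_val (c :: s) end.

Lemma seq_val_cat s t : seq_val (s ++ t) = seq_val s * seq_val t.
Proof. by elim: s => [|c s IHs] /=; rewrite ?mul1g// IHs mulgA. Qed.

Lemma v_nonunit c : ~ invertible (v c).
Proof. by case: ((v_atom (v c)).2 (ex_intro _ c erefl)). Qed.

Lemma length_seq_val c s : lambda (seq_val (c :: s)) <> 0%N.
Proof.
by move=> /eqP; rewrite /= lengthM addn_eq0 => /andP[/eqP/length_eq0/v_nonunit].
Qed.

Lemma v_divl c d u : v c = v d * u -> exists g, u = iota g.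
Proof.
have [_ c_irr] := (v_atom (v c)).2 (ex_intro _ c erefl).
by move=> /c_irr[/v_nonunit //|/iota_units[g <-]]; exists g.
Qed.

(** Uniqueness of factorization into atoms up to units. The end units are kept general because
    peeling off the first atom replaces [g] by an intermediate unit. *)
Lemma tensor_chainP g s t h :
  tensor_chain g s t h <-> seq_val s * iota h = iota g * seq_val t.
Proof.
elim: s t g => [|c s IHs] [|d t] g.
- rewrite tensor_chain_nilE /= mul1g mulg1.
  by split=> [-> //|/iota_inj ->].
(* The empty product has length 0, a nonempty product of atoms does not. *)
- split=> [[//]|/(congr1 lambda)/esym].
  by rewrite length_unitl length_unitr length1 => /length_seq_val.
- split=> [[//]|/(congr1 lambda)].
  by rewrite length_unitl length_unitr length1 => /length_seq_val.
rewrite tensor_chain_cons; split=> [[k [-> /IHs st]]|/=].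
  by rewrite /= v_lact v_ract -mulgA st -!mulgA unitVK.
rewrite -mulgA [RHS]mulgA -v_lact => e.
suff [k dE stE] : exists2 k, v (ract c k) = v (lact g d)
    & seq_val s * iota h = iota k * seq_val t.
  exists k; split; last exact/IHs.
  by apply: v_inj; rewrite v_lact dE v_lact unitK.
(* One leading atom divides the other on the left. The cofactor [u] is a unit by [v_divl], and [k]
   is its inverse or itself according to the case. *)
have [[u [cE tE]]|[u [dE sE]]] := S_equidiv e.
  have [k uE] := v_divl cE; rewrite uE in cE tE.
  exists k^-1; last by rewrite tE unitK.
  by rewrite v_ract cE -mulgA -gmulfM mulgV gmulf1 mulg1.
have [k uE] := v_divl dE; rewrite uE in dE sE.
by exists k; rewrite // v_ract.
Qed.

Lemma word_valP w w' : tensor_word_eq w w' <-> word_val w = word_val w'.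
Proof.
case: w w' => [g|[c s]] [h|[d t]] /=.
- by split=> [-> //|/iota_inj].
- by split=> // /(congr1 lambda)/esym; rewrite length_unit => /length_seq_val.
- by split=> // /(congr1 lambda); rewrite length_unit => /length_seq_val.
- by rewrite tensor_chainP gmulf1 mulg1 mul1g.
Qed.

Lemma word_valM w w' :
  word_val (tensor_word_mul w w') = word_val w * word_val w'.
Proof.
case: w w' => [g|[c s]] [h|[d t]] /=.
- exact: gmulfM.
- by rewrite v_lact mulgA.
- have /tensor_chainP := tensor_chain_ract_last c s h.
  by case: ract_last => d t /=; rewrite gmulf1 mul1g.
- by rewrite seq_val_cat mulgA.
Qed.

Lemma word_val_surj a : exists w, word_val w = a.
Proof.
have [/iota_units[g <-]|] := pselect (invertible a); first by exists (inl g).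
suff P : ~ invertible a -> exists c s, seq_val (c :: s) = a.
  by move=> /P[c [s <-]]; exists (inr (c, s)).
move: a; apply: mulg_nonunit_ind => [x /v_atom[c <-]|a b [c [s <-]] [d [t <-]]].
  by exists c, [::]; rewrite /= mulg1.
by exists c, (s ++ d :: t); rewrite -cat_cons seq_val_cat.
Qed.

(** [word_val] is multiplicative and onto, and by [word_valP] its fibres are exactly the tensor
    classes, so it descends to the quotient. *)
Lemma levi_tensor_monoid : monoid_isomorphic S (tensor_monoid X).
Proof.
pose f (t : tensor_monoid X) := word_val (repr t).
have fE w : f (tensor_class w) = word_val w.
  by apply/word_valP/tensor_eqP; exact: tensor_reprK.
apply: (@monoid_isomorphic_inv _ _ f).
- split=> [|t t']; first by rewrite [LHS]fE /= gmulf1.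
  rewrite -[t]tensor_reprK -[t']tensor_reprK.
  by rewrite [tensor_class _ * _]tensor_mulE !fE word_valM.
- move=> t t' /word_valP/tensor_eqP.
  by rewrite !tensor_reprK.
- by move=> a; have [w <-] := word_val_surj a; exists (tensor_class w).
Qed.

End Presentation.

(** The class of [(g, h)] goes to [iota g * x * iota h]. That this is well defined and injective is
    [relP]; irreducibility makes it reach every atom. *)
Lemma levi_tensor_Xbar (x : S) (H K : groupClosed G)
    (gamma : groupClosed (G * G)%type) :
  equidivisible S -> injective iota -> irreducible_monoid S -> atom x ->
  subdirect H K gamma ->
  (forall h k, (h, k) \in gamma <-> iota h * x = x * iota k) ->
  monoid_isomorphic S (tensor_monoid (Xbar H gamma K)).
Proof.
move=> S_equidiv iota_inj S_irr x_atom [gammaHK _ _] gammaP.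
pose v (c : Xbar H gamma K) := iota (repr c).1 * x * iota (repr c).2.
have relP g h g' h' : xbar_rel H gamma K (g, h) (g', h') <->
    iota g * x * iota h = iota g' * x * iota h'.
  have -> : xbar_rel H gamma K (g, h) (g', h') <->
      (g'^-1 * g, h' * h^-1) \in gamma.
    rewrite /xbar_rel /=; split=> [/and3P[] //|gg'].
    by have [-> ->] := gammaHK _ _ gg'.
  (* Multiplying the linking equation by [iota g'] on the left and [iota h] on the right gives the
     equality of atoms; the inverses lead back. *)
  rewrite gammaP !gmulfM; split=> e.
    have := congr1 (fun a => iota g' * a * iota h) e.
    by rewrite -!mulgA unitVK -gmulfM mulVg gmulf1 mulg1.
  rewrite -(mulgA (iota g'^-1)).
  have -> : iota g * x = (iota g * x * iota h) * iota h^-1.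
    by rewrite -mulgA -gmulfM mulgV gmulf1 mulg1.
  by rewrite e -!mulgA unitK.
have vE g h : v (xbar_class H gamma K g h) = iota g * x * iota h.
  by apply/relP; rewrite -surjective_pairing; apply/xbar_eqP/xbar_reprK.
apply: (@levi_tensor_monoid _ v) => //.
- by move=> g c; rewrite -[c]xbar_reprK [lact _ _]xbar_lactE !vE gmulfM !mulgA.
- by move=> c g; rewrite -[c]xbar_reprK [ract _ _]xbar_ractE !vE gmulfM !mulgA.
- move=> c d; rewrite -[c]xbar_reprK -[d]xbar_reprK !vE => /relP.
  by move=> /xbar_eqP.
- move=> y; split=> [y_atom|[c <-]]; last exact: atom_unitM.
  have [_ [_ [/iota_units[g <-] /iota_units[h <-] ->]]] :=
    S_irr _ _ x_atom y_atom.
  by exists (xbar_class H gamma K g h).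
Qed.

End Levi.

(** The part common to all three cases. [gamma] stays free so that each case can supply its own
    description of the linking subgroup, by quotients or by a graph. *)
Lemma irreducible_levi_linking (G : groupType) (S : monoidType)
    (lambda : S -> nat) (iota : G -> S) :
  levi_monoid lambda -> irreducible_monoid S -> group_of_units iota ->
  exists (j : UMagmaMorphism.type G S) (x : S), injective j /\
    forall (H K : groupClosed G) (gamma : groupClosed (G * G)%type),
      subdirect H K gamma ->
      (forall h k, (h, k) \in gamma <-> (h, k) \in linking j x) ->
      monoid_isomorphic S (tensor_monoid (Xbar H gamma K)).
Proof.
move=> [S_equidiv S_length S_nu] S_irr [iota_morph iota_inj iota_units].
pose m := isUMagmaMorphism.Build G S iota iota_morph.
pose j : UMagmaMorphism.type G S := HB.pack iota m.
have [x x_atom] := exists_atom S_length S_nu; exists j, x; split=> // H K gamma.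
move=> gammaHK gammaP.
apply: (levi_tensor_Xbar (iota := j) S_length) x_atom _ _ => //.
by move=> h k; rewrite gammaP linkingP.
Qed.

Theorem theorem2p35 (G : groupType) :
  (forall (S : monoidType) (lambda : S -> nat) (iota : G -> S),
     levi_monoid lambda -> irreducible_monoid S -> group_of_units iota ->
     exists (H K : groupClosed G)
            (NH : normalClosed (subgroup_type H))
            (NK : normalClosed (subgroup_type K))
            (theta : UMagmaMorphism.type (quotient_group NH)
                                         (quotient_group NK)),
       bijective theta /\
       monoid_isomorphic S
         (tensor_monoid (Xbar H (quotient_relation theta) K)))
  /\
  (forall (S : monoidType) (lambda : S -> nat) (iota : G -> S),
     left_rees_monoid lambda -> irreducible_monoid S -> group_of_units iota ->
     exists (H K : groupClosed G)
            (phi : UMagmaMorphism.type (subgroup_type H) (subgroup_type K)),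
       (forall k, exists h, phi h = k) /\
       monoid_isomorphic S
         (tensor_monoid (Xbar H (graph_relation phi) K)))
  /\
  (forall (S : monoidType) (lambda : S -> nat) (iota : G -> S),
     rees_monoid lambda -> irreducible_monoid S -> group_of_units iota ->
     exists (H K : groupClosed G)
            (phi : UMagmaMorphism.type (subgroup_type H) (subgroup_type K)),
       bijective phi /\
       monoid_isomorphic S
         (tensor_monoid (Xbar H (graph_relation phi) K))).
Proof.
split; [|split] => S lambda iota.
- move=> S_levi S_irr S_units.
  have [j [x [_ S_iso]]] := irreducible_levi_linking S_levi S_irr S_units.
  pose gamma : groupClosed (G * G)%type := linking j x.
  exists (rel_dom gamma : groupClosed G), (rel_cod gamma : groupClosed G).
  exists (rel_kerl (gamma := gamma) : normalClosed _).
  exists (rel_kerr (gamma := gamma) : normalClosed _).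
  exists (rel_theta (gamma := gamma) : UMagmaMorphism.type _ _).
  split; first exact: rel_theta_bij.
  by apply: S_iso (quotient_relation_subdirect (rel_theta_bij _)) _ => h k;
    exact: quotient_relationP.
- move=> [S_levi S_lcancel] S_irr S_units.
  have [j [x [j_inj S_iso]]] := irreducible_levi_linking S_levi S_irr S_units.
  have [phi phi_surj phiP] :=
    functional_rel_graph (linking_fun (x := x) j_inj S_lcancel).
  pose gamma : groupClosed (G * G)%type := linking j x.
  exists (rel_dom gamma : groupClosed G), (rel_cod gamma : groupClosed G), phi.
  split=> //.
  exact: S_iso (graph_relation_subdirect phi_surj) phiP.
- move=> [S_levi S_lcancel S_rcancel] S_irr S_units.
  have [j [x [j_inj S_iso]]] := irreducible_levi_linking S_levi S_irr S_units.
  have [phi phi_surj phiP] :=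
    functional_rel_graph (linking_fun (x := x) j_inj S_lcancel).
  pose gamma : groupClosed (G * G)%type := linking j x.
  exists (rel_dom gamma : groupClosed G), (rel_cod gamma : groupClosed G), phi.
  split; last exact: S_iso (graph_relation_subdirect phi_surj) phiP.
  have /choice[f fK] := phi_surj.
  suff phi_inj : injective phi by exists f => // h; apply: phi_inj; rewrite fK.
  (* If [phi h = phi h'], this equation gives [j (val h) * x = j (val h') * x], and [x] cancels on
     the right. *)
  have graphP h : j (val h) * x = x * j (val (phi h)).
    by apply/linkingP/phiP/asboolP; exists h.
  move=> h h' e; apply/val_inj/j_inj/(S_rcancel x).
  by rewrite !graphP e.
Qed.
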